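(* Let $k$ be an algebraically closed field of characteristic zero and let $H=(1,m,n,\tau)$ be an $h$-vector (with $m,n,\tau$ positive integers). Then $H$ is the $h$-vector of an Artinian level local $k$-algebra if and only if $n\leqslant \tau m$.
   Context: An Artinian local $k$-algebra $(A,\mathfrak m,k)$ here has residue field $k$. Its socle degree is the integer $s$ with $\mathfrak{m}^s\neq 0$ and $\mathfrak{m}^{s+1}=0$. It is level (more precisely $s$-level of type $\tau$) if $\mathrm{Soc}(A):=0:_A\mathfrak{m}=\mathfrak{m}^s$ and $\dim_k\mathrm{Soc}(A)=\tau$. The Hilbert function of $A$ is $HF_A(j)=\dim_k\mathfrak{m}^j/\mathfrak{m}^{j+1}$, and the $h$-vector of $A$ is $(HF_A(0),\ldots,HF_A(s))$, where $s$ is the socle degree of $A$. A numerical sequence ''is an $h$-vector'' if it is the $h$-vector of some Artinian local (equivalently, Artinian standard graded) $k$-algebra, equivalently if it satisfies the growth conditions of Macaulay's theorem characterizing Hilbert functions of standard graded $k$-algebras. *)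

(* Defs.v *)
From HB Require Import structures.
From mathcomp Require Import all_boot all_algebra.
From mathcomp Require Import boolp classical_sets.

Set Implicit Arguments.
Unset Strict Implicit.
Unset Printing Implicit Defensive.

Import GRing.Theory.
Local Open Scope classical_set_scope.
Local Open Scope ring_scope.

Section Ideals.
Variable A : comNzRingType.
Implicit Types (I J M : set A).

Definition is_ideal I : Prop :=
  [/\ I 0, forall x y, I x -> I y -> I (x + y) & forall a x, I x -> I (a * x)].

Definition maximal_ideal M : Prop :=
  [/\ is_ideal M, M <> setT &
      forall I, is_ideal I -> M `<=` I -> I = M \/ I = setT].

Definition artinian_ring : Prop :=
  forall I : nat -> set A,
    (forall i, is_ideal (I i)) -> (forall i, I i.+1 `<=` I i) ->
    exists N, forall i, (N <= i)%N -> I i = I N.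

Definition ideal_mul I J : set A :=
  [set x | exists r (a b : 'I_r -> A),
     (forall i, I (a i) /\ J (b i)) /\ x = \sum_(i < r) a i * b i].

Fixpoint ideal_pow M (j : nat) : set A :=
  if j is j'.+1 then ideal_mul M (ideal_pow M j') else setT.

(* 0 :_A M, the socle of A when M is the maximal ideal of the local ring A *)
Definition socle M : set A := [set x | forall y, M y -> x * y = 0].

Definition socle_degree M (s : nat) : Prop :=
  ideal_pow M s <> [set 0] /\ ideal_pow M s.+1 = [set 0].

End Ideals.

Section LocalAlgebras.
Variables (k : fieldType) (A : comAlgType k).
Implicit Types (I J M : set A).

(* (A, M) is an Artinian local k-algebra with residue field k.  The last clause
   says that k -> A / M is surjective; it is injective because M is proper. *)
Definition artinian_local M : Prop :=
  [/\ artinian_ring A,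
      maximal_ideal M,
      forall I, maximal_ideal I -> I = M &
      forall a : A, exists c : k, M (a - c%:A)].

(* For k-subspaces J `<=` I: dim_k (I / J) = d, witnessed by d elements of I
   whose classes form a k-basis of I / J *)
Definition quo_dim I J (d : nat) : Prop :=
  exists e : 'I_d -> A,
    [/\ forall i, I (e i),
        forall x, I x -> exists c : 'I_d -> k, J (x - \sum_(i < d) c i *: e i) &
        forall c : 'I_d -> k,
          J (\sum_(i < d) c i *: e i) -> forall i, c i = 0].

(* HF_A(j) = d *)
Definition hilbert_fun M (j d : nat) : Prop :=
  quo_dim (ideal_pow M j) (ideal_pow M j.+1) d.

Definition h_vector M (H : seq nat) : Prop :=
  exists s, [/\ socle_degree M s, size H = s.+1 &
                forall j, (j <= s)%N -> hilbert_fun M j (nth 0%N H j)].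

(* s-level of type tau *)
Definition s_level M (s tau : nat) : Prop :=
  [/\ socle_degree M s, socle M = ideal_pow M s &
      quo_dim (socle M) [set 0] tau].

Definition level M : Prop := exists s tau, s_level M s tau.

End LocalAlgebras.

Definition is_h_vector (k : fieldType) (H : seq nat) : Prop :=
  exists (A : comAlgType k) (M : set A), artinian_local M /\ h_vector M H.

Definition is_level_h_vector (k : fieldType) (H : seq nat) : Prop :=
  exists (A : comAlgType k) (M : set A),
    [/\ artinian_local M, level M & h_vector M H].

(* Main.v *)
Require Import Defs.
From HB Require Import structures.
From mathcomp Require Import all_boot all_algebra.
From mathcomp Require Import boolp classical_sets ring zify.

(** Why the theorem holds.

    If [(A, M)] is level with [h]-vector [(1, m, n, tau)], then an element of
    [M^2] killed by [M] lies in the socle [M^3]; hence multiplication embeds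
    [M^2 / M^3] into [Hom (M / M^2, M^3)] and [n <= m * tau]
    ([level_type_bound]).

    Conversely, let [G] be a tuple of [tau] linearly independent cubic forms in
    [m] variables (symmetric trilinear forms on [V = k^m]) whose first derivatives
    span a space of dimension exactly [n].  Then [k + V + k^n + k^tau] carries a
    graded algebra structure in which [k^n] is dual to the space of derivatives.
    No element of degree two is in its socle.  An element of [V] can be, when the
    forms do not involve all the variables; adding to the product of two vectors
    a term of top degree, a symmetric bilinear form nondegenerate on those
    elements, makes the algebra level without changing its [h]-vector
    ([level_h_vector_of_tensor]).  In terms of inverse systems, this adds squares
    of the missing variables to one of the cubic forms.

    So it remains to find [G], and only existence of some algebra with the given
    [h]-vector is needed from the hypothesis, not the numerical criterion of
    Macaulay.  The triple products in that algebra give independent forms whose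
    derivatives span a space of dimension at most [n] ([multiplication_tensor]).
    The sums of the monomials [x_j^2 x_(j+i)], for [j] modulo [m] and [i < tau],
    have derivatives spanning a space of dimension the minimum of [m * tau] and
    the number of quadratic monomials, hence at least [n] ([cyclic_tensor_rank]).
    To interpolate between the two, note that in characteristic zero every cubic
    form is a combination of cubes of linear forms, and that adding such a cube
    to one of the forms changes the catalecticant matrix by a matrix of rank one.
    A generic path made of such steps keeps the forms independent and cannot jump
    over the value [n] ([exists_symmetric_tensor_rank]). *)

Set Implicit Arguments.
Unset Strict Implicit.
Unset Printing Implicit Defensive.
Import GRing.Theory.

(** * Powers of an ideal *)

Section IdealPowers.
Local Open Scope classical_set_scope.
Local Open Scope ring_scope.
Variable A : comNzRingType.
Implicit Types (I J M P : set A).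

Lemma ideal_mul_min I J P :
    P 0 -> (forall x y, P x -> P y -> P (x + y)) ->
    (forall a b, I a -> J b -> P (a * b)) ->
  ideal_mul I J `<=` P.
Proof.
move=> P0 PD PM _ [r [a [b [ab ->]]]].
by apply: (big_ind P) => // i _; have [] := ab i; apply: PM.
Qed.

Lemma mem_ideal_mul I J a b : I a -> J b -> ideal_mul I J (a * b).
Proof.
by move=> Ia Jb; exists 1, (fun=> a), (fun=> b); split=> //; rewrite big_ord1.
Qed.

Lemma ideal_mul_ideal I J : is_ideal I -> is_ideal (ideal_mul I J).
Proof.
move=> [_ _ IM]; split.
- by exists 0, (fun=> 0), (fun=> 0); split=> [[]//|]; rewrite big_ord0.
- move=> _ _ [r [a [b [ab ->]]]] [s [c [d [cd ->]]]].
  exists (r + s)%N, (fun i => match split i with inl j => a j | inr j => c j end),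
    (fun i => match split i with inl j => b j | inr j => d j end); split.
    by move=> i; case: (split i).
  rewrite big_split_ord /=; congr (_ + _); apply: eq_bigr => i _.
    by rewrite (unsplitK (inl i)).
  by rewrite (unsplitK (inr i)).
- move=> x _ [r [a [b [ab ->]]]].
  exists r, (fun i => x * a i), b; split.
    by move=> i; have [Ia Jb] := ab i; split=> //; apply: IM.
  by rewrite mulr_sumr; apply: eq_bigr => i _; rewrite mulrA.
Qed.

Lemma ideal_pow_ideal M j : is_ideal M -> is_ideal (ideal_pow M j).
Proof. by case: j => [|j] idM //=; apply: ideal_mul_ideal. Qed.

Lemma ideal_powS M j : is_ideal M -> ideal_pow M j.+1 `<=` ideal_pow M j.
Proof.
move=> idM; have [M0 MD MM] := ideal_pow_ideal j idM.
by apply: ideal_mul_min => // a b _; apply: MM.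
Qed.

Lemma ideal_pow_le M i j :
  is_ideal M -> (i <= j)%N -> ideal_pow M j `<=` ideal_pow M i.
Proof.
move=> idM /subnK <-; elim: (j - i)%N => [|d IHd] //.
by apply: subset_trans IHd; rewrite addSn; apply: ideal_powS.
Qed.

Lemma ideal_pow1 M : is_ideal M -> ideal_pow M 1 = M.
Proof.
move=> idM; have [M0 MD MM] := idM; apply/seteqP; split=> [|x Mx].
  by apply: ideal_mul_min => // a b Ma _; rewrite mulrC; apply: MM.
by rewrite -[x]mulr1; apply: mem_ideal_mul.
Qed.

(** Splitting off one factor of [M] at a time reduces this to the definition of
    the powers; it drives every degree count below. *)
Lemma mem_ideal_powD M i j a b : is_ideal M ->
  ideal_pow M i a -> ideal_pow M j b -> ideal_pow M (i + j) (a * b).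
Proof.
move=> idM; elim: i a => [|i IHi] a.
  by move=> _; have [_ _] := ideal_pow_ideal j idM; apply.
have [M0 MD MM] := ideal_pow_ideal (i.+1 + j) idM.
move=> + Jb; move: a.
apply: (@ideal_mul_min _ _ (fun a => ideal_pow M (i.+1 + j) (a * b))).
- by rewrite mul0r.
- by move=> x y Px Py; rewrite mulrDl; apply: MD.
- by move=> x y Mx My; rewrite -mulrA addSn; apply: mem_ideal_mul (IHi _ _ _).
Qed.

Lemma socle_degree_unique M s t :
  is_ideal M -> socle_degree M s -> socle_degree M t -> s = t.
Proof.
move=> idM.
have le (i j : nat) : socle_degree M i -> socle_degree M j -> (i <= j)%N.
  move=> [Mi _] [_ Mj]; rewrite leqNgt; apply/negP => ji; apply: Mi.
  apply/seteqP; split=> [x /(ideal_pow_le idM ji)|_ ->]; first by rewrite Mj.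
  by have [] := ideal_pow_ideal i idM.
by move=> hs ht; apply/eqP; rewrite eqn_leq !le.
Qed.

End IdealPowers.

Section IdealLinear.
Local Open Scope classical_set_scope.
Local Open Scope ring_scope.
Variables (k : fieldType) (A : comAlgType k) (I : set A).
Hypothesis idI : is_ideal I.

Lemma idealD x y : I x -> I y -> I (x + y).
Proof. by have [_ + _] := idI; apply. Qed.

Lemma ideal_sum (J : finType) (P : pred J) (F : J -> A) :
  (forall i, P i -> I (F i)) -> I (\sum_(i | P i) F i).
Proof. by have [I0 ID _] := idI; move=> IF; apply: (big_ind I). Qed.

Lemma idealZ (c : k) x : I x -> I (c *: x).
Proof. by have [_ _ IM] := idI; rewrite -mulr_algl; apply: IM. Qed.

Lemma idealB x y : I x -> I y -> I (x - y).
Proof. by move=> Ix Iy; rewrite -scaleN1r; apply: idealD => //; apply: idealZ. Qed.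

End IdealLinear.

(** * Families of symmetric trilinear forms *)

Section Tensors.
Local Open Scope ring_scope.
Variables (k : fieldType) (m tau : nat).
Local Notation ix := (@mxvec_index _ _).
Implicit Types (D : 'M[k]_(m * m, m * tau)).

Lemma sum_mxvec_index (V : nmodType) a b (F : 'I_(a * b) -> V) :
  \sum_x F x = \sum_i \sum_j F (mxvec_index i j).
Proof.
by rewrite (reindex _ (curry_mxvec_bij _ _)) [RHS]pair_bigA; apply: eq_bigr => -[].
Qed.

(** A [tau]-tuple [T] of trilinear forms on [k^m] is stored as its catalecticant
    matrix: the pair [(p, q)] indexes the rows, the pair [(r, i)] the columns.
    Up to transposition this is the map sending a direction [r] and a form [i]
    to the contraction of the form along the direction, so that its rank is the
    dimension of the space spanned by the first derivatives of the forms. *)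
Definition tensor_mx (T : 'I_m -> 'I_m -> 'I_m -> 'I_tau -> k) :
    'M_(m * m, m * tau) :=
  \matrix_(a, b) mxvec (\matrix_(p, q) mxvec (\matrix_(r, i) T p q r i) 0 b) 0 a.

Lemma tensor_mxE T p q r i : tensor_mx T (ix p q) (ix r i) = T p q r i.
Proof. by rewrite mxE mxvecE mxE mxvecE mxE. Qed.

Lemma tensor_mxP D1 D2 :
  (forall p q r i, D1 (ix p q) (ix r i) = D2 (ix p q) (ix r i)) -> D1 = D2.
Proof.
move=> eqD; apply/matrixP => a b.
by case/mxvec_indexP: a => p q; case/mxvec_indexP: b => r i.
Qed.

Definition symmetric_tensor D : Prop := forall p q r i,
  D (ix p q) (ix r i) = D (ix q p) (ix r i) /\
  D (ix p q) (ix r i) = D (ix p r) (ix q i).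

(** The same tensor with all three directions moved to the rows: it has full
    column rank exactly when the [tau] forms are linearly independent, or,
    dually, when the vectors [T p q r] span [k^tau]. *)
Definition flattening D : 'M_(m * m * m, tau) :=
  \matrix_(a, i) mxvec (\matrix_(x, r) D x (ix r i)) 0 a.

Lemma flatteningE D p q r i :
  flattening D (ix (ix p q) r) i = D (ix p q) (ix r i).
Proof. by rewrite mxE mxvecE mxE. Qed.

End Tensors.

Section QuotientBasis.
Local Open Scope ring_scope.
Variables (k : fieldType) (A : comAlgType k) (J : set A) (d : nat) (e : 'I_d -> A).
Hypotheses (idJ : is_ideal J)
  (freeJ : forall c : 'I_d -> k, J (\sum_(i < d) c i *: e i) -> forall i, c i = 0).

Lemma quo_coord_unique x (c c' : 'I_d -> k) :
  J (x - \sum_(i < d) c i *: e i) -> J (x - \sum_(i < d) c' i *: e i) ->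
  c =1 c'.
Proof.
move=> Jc Jc' i; apply/eqP; rewrite -subr_eq0; apply/eqP.
apply: (freeJ (c := fun i => c i - c' i)).
under eq_bigr do rewrite scalerBl; rewrite sumrB.
have := idealB idJ Jc' Jc; congr J.
by rewrite opprB addrC addrA subrK.
Qed.
End QuotientBasis.

(** * The forms carried by an algebra of socle degree three *)

Section SocleDegreeThree.
Local Open Scope classical_set_scope.
Local Open Scope ring_scope.
Variables (k : fieldType) (A : comAlgType k) (M : set A) (m n tau : nat).
Hypotheses (idM : is_ideal M) (M4 : ideal_pow M 4 = [set 0]).
Variables (e : 'I_m -> A) (f : 'I_n -> A) (g : 'I_tau -> A).
Hypotheses (e_in : forall p, ideal_pow M 1 (e p))
  (e_gen : forall x, ideal_pow M 1 x ->
     exists c : 'I_m -> k, ideal_pow M 2 (x - \sum_(i < m) c i *: e i)).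
Hypotheses (f_in : forall p, ideal_pow M 2 (f p))
  (f_gen : forall x, ideal_pow M 2 x ->
     exists c : 'I_n -> k, ideal_pow M 3 (x - \sum_(i < n) c i *: f i))
  (f_free : forall c : 'I_n -> k,
          ideal_pow M 3 (\sum_(i < n) c i *: f i) -> forall i, c i = 0).
Hypotheses (g_in : forall p, ideal_pow M 3 (g p))
  (g_gen : forall x, ideal_pow M 3 x ->
     exists c : 'I_tau -> k, ideal_pow M 4 (x - \sum_(i < tau) c i *: g i))
  (g_free : forall c : 'I_tau -> k,
          ideal_pow M 4 (\sum_(i < tau) c i *: g i) -> forall i, c i = 0).

Let idP j := ideal_pow_ideal j idM.

Let pow4_eq0 j x : ideal_pow M (4 + j) x -> x = 0.
Proof. by move/(ideal_pow_le idM (leq_addr j 4)); rewrite M4. Qed.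

(** Multiplication embeds [M^2 / M^3] into [Hom (M / M^2, M^3)]: a class in the
    kernel is represented by some [x] in [M^2] with [x M = 0], because [M^2 M^2]
    vanishes, and such an [x] lies in the socle, which is [M^3]. *)
Lemma level_type_bound : socle M = ideal_pow M 3 -> (n <= m * tau)%N.
Proof.
move=> socM.
have /choice[r rP] : forall cp : 'I_n * 'I_m, exists r : 'I_tau -> k,
    ideal_pow M 4 (f cp.1 * e cp.2 - \sum_i r i *: g i).
  by move=> [c p]; apply/g_gen/(mem_ideal_powD (i := 2) (j := 1)).
pose R : 'M_(n, m * tau) := \matrix_(c, b) mxvec (\matrix_(p, i) r (c, p) i) 0 b.
suff /eqP <- : row_free R by apply: rank_leq_col.
apply: inj_row_free => v vR0.
pose x := \sum_c v 0 c *: f c.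
suff : ideal_pow M 3 x by move=> /f_free v0; apply/rowP => c; rewrite v0 mxE.
have x2 : ideal_pow M 2 x.
  by apply: ideal_sum => // c _; apply: idealZ.
rewrite -socM => y; rewrite -{1}(ideal_pow1 idM) => /e_gen[a ya].
have xe p : x * e p = 0.
  rewrite mulr_suml (eq_bigr (fun c => \sum_i (v 0 c * r (c, p) i) *: g i)).
    rewrite exchange_big big1 // => i _; rewrite -scaler_suml.
    have /rowP/(_ (mxvec_index p i)) := vR0; rewrite !mxE.
    under eq_bigr do rewrite mxE mxvecE mxE.
    by move=> ->; rewrite scale0r.
  move=> c _; have /(pow4_eq0 (j := 0))/eqP := rP (c, p).
  rewrite subr_eq0 /= -scalerAl => /eqP ->.
  by rewrite scaler_sumr; apply: eq_bigr => i _; rewrite scalerA.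
have -> : x * y = x * (y - \sum_i a i *: e i) + x * \sum_i a i *: e i.
  by rewrite -mulrDr subrK.
rewrite mulr_sumr [X in _ + X]big1 ?addr0 => [|p _]; last first.
  by rewrite -scalerAr xe scaler0.
apply: (pow4_eq0 (j := 0)).
exact: (mem_ideal_powD (i := 2) (j := 2)).
Qed.

(** Replacing a factor of a product by its expansion on the [e p] changes the
    product by a term of the next power of [M]. *)
Lemma pow2_span x : ideal_pow M 2 x -> exists b : 'I_m -> 'I_m -> k,
  ideal_pow M 3 (x - \sum_p \sum_q b p q *: (e p * e q)).
Proof.
apply: (@ideal_mul_min _ _ _ (fun x => exists b : 'I_m -> 'I_m -> k,
  ideal_pow M 3 (x - \sum_p \sum_q b p q *: (e p * e q)))).
- exists (fun _ _ => 0); rewrite big1 ?subr0 => [|p _]; last first.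
    by rewrite big1 // => q _; rewrite scale0r.
  by have [] := idP 3.
- move=> y z [b by_] [c cz]; exists (fun p q => b p q + c p q).
  have := idealD (idP 3) by_ cz; congr (ideal_pow M 3 _).
  rewrite addrACA -opprD -big_split /=; congr (_ - _).
  apply: eq_bigr => p _; rewrite -big_split /=.
  by apply: eq_bigr => q _; rewrite scalerDl.
move=> a b; rewrite -{1}(ideal_pow1 idM) => Ma Mb.
have [c ac] := e_gen Ma; have [d bd] := e_gen Mb.
exists (fun p q => c p * d q).
set x1 := \sum_(i < m) _ in ac; set y1 := \sum_(i < m) _ in bd.
have y1M : ideal_pow M 1 y1 by apply: ideal_sum => // i _; apply: idealZ.
have -> : \sum_p \sum_q (c p * d q) *: (e p * e q) = x1 * y1.
  rewrite mulr_suml; apply: eq_bigr => p _; rewrite mulr_sumr.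
  by apply: eq_bigr => q _; rewrite -scalerAl -scalerAr scalerA.
have -> : a * b - x1 * y1 = a * (b - y1) + (a - x1) * y1.
  by rewrite mulrBr mulrBl addrA subrK.
apply: idealD => //.
  exact: (mem_ideal_powD (i := 1) (j := 2)).
exact: (mem_ideal_powD (i := 2) (j := 1)).
Qed.

Lemma pow3_span x : ideal_pow M 3 x -> exists b : 'I_m -> 'I_m -> 'I_m -> k,
  x = \sum_r \sum_p \sum_q b p q r *: (e r * (e p * e q)).
Proof.
apply: (@ideal_mul_min _ _ _ (fun x => exists b : 'I_m -> 'I_m -> 'I_m -> k,
  x = \sum_r \sum_p \sum_q b p q r *: (e r * (e p * e q)))).
- exists (fun _ _ _ => 0); rewrite big1 // => r _.
  by rewrite big1 // => p _; rewrite big1 // => q _; rewrite scale0r.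
- move=> y z [b ->] [c ->]; exists (fun p q r => b p q r + c p q r).
  rewrite -big_split; apply: eq_bigr => r _; rewrite -big_split.
  apply: eq_bigr => p _; rewrite -big_split /=.
  by apply: eq_bigr => q _; rewrite scalerDl.
move=> a b; rewrite -{1}(ideal_pow1 idM) => Ma Mb.
have [c ac] := e_gen Ma; have [d bd] := pow2_span Mb.
exists (fun p q r => c r * d p q).
set x1 := \sum_(i < m) _ in ac; set y1 := \sum_(i < m) _ in bd.
have y1M : ideal_pow M 2 y1.
  do 2![apply: ideal_sum => // ? _]; apply: idealZ => //.
  exact: (mem_ideal_powD (i := 1) (j := 1)).
have -> : \sum_r \sum_p \sum_q (c r * d p q) *: (e r * (e p * e q)) = x1 * y1.
  rewrite mulr_suml; apply: eq_bigr => r _; rewrite mulr_sumr.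
  apply: eq_bigr => p _; rewrite mulr_sumr.
  by apply: eq_bigr => q _; rewrite -scalerAl -scalerAr scalerA.
apply/eqP; rewrite -subr_eq0; apply/eqP/(pow4_eq0 (j := 0)).
have -> : a * b - x1 * y1 = a * (b - y1) + (a - x1) * y1.
  by rewrite mulrBr mulrBl addrA subrK.
apply: idealD => //.
  exact: (mem_ideal_powD (i := 1) (j := 3)).
exact: (mem_ideal_powD (i := 2) (j := 2)).
Qed.

(** The structure constants of the triple products [e p * e q * e r] form a
    symmetric tensor.  Its catalecticant factors through the [n] coordinates of
    [e p * e q] in [M^2 / M^3], which bounds its rank by [n]; the rank may be
    smaller, since nothing prevents a class of [M^2 / M^3] from being killed
    by [M].  The other matrix [mu], of the products [e p * e q] alone, records
    that [n] is at most the number of quadratic monomials. *)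
Lemma multiplication_tensor :
  exists (mu : 'M[k]_(m * m, n)) (D : 'M[k]_(m * m, m * tau)),
  [/\ forall p q, row (mxvec_index p q) mu = row (mxvec_index q p) mu,
      row_full mu, symmetric_tensor D, row_full (flattening D) &
      (\rank D <= n)%N].
Proof.
have e2 p q : ideal_pow M 2 (e p * e q).
  exact: (mem_ideal_powD (i := 1) (j := 1)).
have /choice[u uP] : forall pq : 'I_m * 'I_m, exists u : 'I_n -> k,
    ideal_pow M 3 (e pq.1 * e pq.2 - \sum_c u c *: f c).
  by move=> [p q]; apply: f_gen.
have /choice[T TP] : forall x : 'I_m * 'I_m * 'I_m, exists r : 'I_tau -> k,
    ideal_pow M 4 (e x.2 * (e x.1.1 * e x.1.2) - \sum_i r i *: g i).
  by move=> [[p q] r]; apply/g_gen/(mem_ideal_powD (i := 1) (j := 2)).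
have /choice[w wP] : forall cr : 'I_n * 'I_m, exists r : 'I_tau -> k,
    ideal_pow M 4 (e cr.2 * f cr.1 - \sum_i r i *: g i).
  by move=> [c p]; apply/g_gen/(mem_ideal_powD (i := 1) (j := 2)).
pose mu : 'M_(m * m, n) := \matrix_(a, c) mxvec (\matrix_(p, q) u (p, q) c) 0 a.
pose D := tensor_mx (fun p q r => T (p, q, r)).
have muE p q c : mu (mxvec_index p q) c = u (p, q) c by rewrite !(mxE, mxvecE).
exists mu, D; split.
- move=> p q; apply/rowP => c; rewrite !mxE !mxvecE !mxE.
  apply: (quo_coord_unique (idP 3) f_free) (uP (p, q)) _ c.
  by have /= := uP (q, p); rewrite [e q * e p]mulrC.
- have /choice[b bP] : forall c, exists b : 'I_m -> 'I_m -> k,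
    ideal_pow M 3 (f c - \sum_p \sum_q b p q *: (e p * e q)).
    by move=> c; apply: pow2_span.
  apply/row_fullP; exists (\matrix_c mxvec (\matrix_(p, q) b c p q)).
  apply/matrixP => c c'; rewrite !mxE sum_mxvec_index.
  under eq_bigr do under eq_bigr do rewrite mxE mxvecE mxE muE.
  apply: (quo_coord_unique (idP 3) f_free (x := f c)
    (c := fun c' => \sum_p \sum_q b c p q * u (p, q) c')
    (c' := fun c' => (c == c')%:R)).
    have err3 : ideal_pow M 3
        (\sum_p \sum_q b c p q *: (e p * e q - \sum_c u (p, q) c *: f c)).
      apply: ideal_sum => // p _; apply: ideal_sum => // q _.
      by apply: idealZ => //; apply: (uP (_, _)).
    have := idealD (idP 3) (bP c) err3.
    have -> : \sum_p \sum_q b c p q *: (e p * e q - \sum_c u (p, q) c *: f c) =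
        \sum_p \sum_q b c p q *: (e p * e q) -
        \sum_(i < n) (\sum_p \sum_q b c p q * u (p, q) i) *: f i.
      under [X in _ = _ - X]eq_bigr do rewrite scaler_suml.
      rewrite [X in _ = _ - X]exchange_big -sumrB; apply: eq_bigr => p _ /=.
      under [X in _ = _ - X]eq_bigr do rewrite scaler_suml.
      rewrite [X in _ = _ - X]exchange_big -sumrB; apply: eq_bigr => q _ /=.
      rewrite scalerBr scaler_sumr; congr (_ - _).
      by apply: eq_bigr => i _; rewrite scalerA.
    by rewrite addrA subrK.
  rewrite (bigD1 c) //= eqxx scale1r big1 ?addr0 ?subrr => [|i /negPf].
    by have [] := idP 3.
  by rewrite eq_sym => ->; rewrite scale0r.
- move=> p q r i; rewrite !tensor_mxE.
  by split; apply: (quo_coord_unique (idP 4) g_free) (TP (p, q, r)) _ i;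
    [have /= := TP (q, p, r) | have /= := TP (p, r, q)];
    rewrite [e q * _]mulrC // mulrA [e r * e p]mulrC mulrAC.
- have /choice[b bP] : forall c, exists b : 'I_m -> 'I_m -> 'I_m -> k,
    g c = \sum_r \sum_p \sum_q b p q r *: (e r * (e p * e q)).
    by move=> c; apply: pow3_span.
  apply/row_fullP.
  exists (\matrix_c mxvec (\matrix_(x, r) mxvec (\matrix_(p, q) b c p q r) 0 x)).
  apply/matrixP => c c'; rewrite !mxE sum_mxvec_index exchange_big.
  under eq_bigr do rewrite sum_mxvec_index.
  under eq_bigr do under eq_bigr do under eq_bigr do
    rewrite flatteningE tensor_mxE mxE mxvecE mxE mxvecE mxE.
  apply: (quo_coord_unique (idP 4) g_free (x := g c)
    (c := fun c' => \sum_r \sum_p \sum_q b c p q r * T (p, q, r) c')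
    (c' := fun c' => (c == c')%:R)).
    rewrite [X in X - _]bP; under [X in _ - X]eq_bigr do rewrite scaler_suml.
    rewrite [X in _ - X]exchange_big -sumrB; apply: (ideal_sum (idP 4)) => r _ /=.
    under [X in _ - X]eq_bigr do rewrite scaler_suml.
    rewrite [X in _ - X]exchange_big -sumrB; apply: (ideal_sum (idP 4)) => p _ /=.
    under [X in _ - X]eq_bigr do rewrite scaler_suml.
    rewrite [X in _ - X]exchange_big -sumrB; apply: (ideal_sum (idP 4)) => q _ /=.
    under [X in _ - X]eq_bigr do rewrite -scalerA.
    by rewrite -scaler_sumr -scalerBr; apply: (idealZ (idP 4)); apply: (TP (_, _, _)).
  rewrite (bigD1 c) //= eqxx scale1r big1 ?addr0 ?subrr => [|i /negPf].
    by have [] := idP 4.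
  by rewrite eq_sym => ->; rewrite scale0r.
have -> : D = mu *m \matrix_c mxvec (\matrix_(r, i) w (c, r) i).
  apply: tensor_mxP => p q r i; rewrite tensor_mxE !mxE.
  under eq_bigr do rewrite muE mxE mxvecE mxE.
  apply: (quo_coord_unique (idP 4) g_free
    (c' := fun i => \sum_c u (p, q) c * w (c, r) i)) (TP (p, q, r)) _ i.
  have err4 : ideal_pow M 4
      (\sum_c u (p, q) c *: (e r * f c - \sum_i w (c, r) i *: g i)).
    apply: ideal_sum => // c _.
    by apply: idealZ => //; apply: (wP (_, _)).
  have := idealD (idP 4)
    (mem_ideal_powD (i := 1) (j := 3) idM (e_in r) (uP (p, q))) err4.
  have -> : \sum_c u (p, q) c *: (e r * f c - \sum_i w (c, r) i *: g i) =
      e r * (\sum_c u (p, q) c *: f c) -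
      \sum_i (\sum_c u (p, q) c * w (c, r) i) *: g i.
    under [X in _ = _ - X]eq_bigr do rewrite scaler_suml.
    rewrite [X in _ = _ - X]exchange_big mulr_sumr -sumrB.
    apply: eq_bigr => c _ /=; rewrite scalerBr -scalerAr scaler_sumr.
    by congr (_ - _); apply: eq_bigr => j _; rewrite scalerA.
  by rewrite mulrBr addrA subrK.
exact: leq_trans (mxrankM_maxl _ _) (rank_leq_col _).
Qed.

End SocleDegreeThree.

(** * Tensors of prescribed rank *)

Section GenericRank.
Local Open Scope ring_scope.

Lemma discrete_ivt (r : nat -> nat) (N n : nat) :
    (forall j, (j < N)%N -> (r j.+1 <= (r j).+1)%N) -> (r 0 <= n <= r N)%N ->
  exists2 j, (j <= N)%N & r j = n.
Proof.
elim: N => [|N IHN] step /andP[r0 rN].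
  by exists 0 => //; apply/eqP; rewrite eqn_leq r0.
have [nN|Nn] := leqP n (r N).
  have [j jN <-] := IHN (fun j jN => step j (ltnW jN)) (introT andP (conj r0 nN)).
  by exists j => //; apply: leqW.
by exists N.+1 => //; apply/eqP; rewrite eqn_leq rN (leq_trans (step N _) Nn).
Qed.

Variable k : fieldType.

(** Along a line of matrices the rank at a point is attained or exceeded outside
    the zeros of a polynomial: with [L] and [R] one-sided inverses taken from
    the full rank factorization at [t0], the determinant of [L (X + t Y) R] is
    such a polynomial, equal to [1] at [t0]. *)
Lemma generic_rank a b (X Y : 'M[k]_(a, b)) t0 : exists P : {poly k},
  P != 0 /\ forall t, P.[t] != 0 -> (\rank (X + t0 *: Y)%R <= \rank (X + t *: Y)%R)%N.
Proof.
set Z := X + t0 *: Y.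
pose L := pinvmx (col_base Z); pose R := pinvmx (row_base Z).
pose P := \det (map_mx polyC (L *m X *m R) + 'X *: map_mx polyC (L *m Y *m R)).
have PE t : P.[t] = \det (L *m (X + t *: Y) *m R).
  rewrite -[P.[t]]/(horner_eval t P) -det_map_mx; congr (\det _).
  apply/matrixP => i j; rewrite mulmxDr mulmxDl -scalemxAr -scalemxAl.
  move: (L *m X *m R) (L *m Y *m R) => U V.
  by rewrite !mxE /= /horner_eval hornerD hornerM hornerX !hornerC.
have P_t0 : P.[t0] = 1.
  have -> : P.[t0] = \det (L *m (col_base Z *m row_base Z) *m R).
    by rewrite PE mulmx_base.
  rewrite mulmxA mulVpmx ?col_base_full // mul1mx mulmxVp ?row_base_free //.
  exact: det1.
exists P; split=> [|t].
  by apply: contra_eq_neq P_t0 => ->; rewrite horner0 eq_sym oner_eq0.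
rewrite PE -unitfE -/(_ \in unitmx) => /mxrank_unit rk.
rewrite -{1}rk; apply: leq_trans (mxrankM_maxl _ _) (mxrankM_maxr _ _).
Qed.

Hypothesis char0 : [pchar k] =i pred0.

Lemma exists_nonroot (P : {poly k}) : P != 0 -> exists t, P.[t] != 0.
Proof.
move=> P0; apply: contrapT => all_root.
pose s : seq k := [seq i%:R | i <- iota 0 (size P)].
have := @max_poly_roots _ P s P0; rewrite size_map size_iota ltnn.
have natr_inj : injective (fun i : nat => i%:R : k).
  have le i j : i%:R = j%:R :> k -> (i <= j)%N.
    move=> eq_ij; rewrite leqNgt; apply/negP => ji.
    have /eqP := eq_ij; rewrite -subr_eq0 -natrB ?(ltnW ji) //.
    by rewrite (pcharf0P k).1 // subn_eq0 leqNgt ji.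
  by move=> i j eq_ij; apply/eqP; rewrite eqn_leq !le.
rewrite map_inj_uniq // iota_uniq => roots_lt.
suff rootP : all (root P) s by have := roots_lt rootP isT.
apply/allP => _ /mapP[i _ ->]; apply: contrapT => /negP nr.
by apply: all_root; exists i%:R.
Qed.

End GenericRank.

Section Polarization.
Local Open Scope ring_scope.
Variables (k : fieldType) (m tau : nat).
Hypothesis char0 : [pchar k] =i pred0.
Local Notation ix := (@mxvec_index _ _).
Implicit Types (D H : 'M[k]_(m * m, m * tau)).

Lemma symmetric_tensorD D1 D2 :
  symmetric_tensor D1 -> symmetric_tensor D2 -> symmetric_tensor (D1 + D2).
Proof.
move=> s1 s2 p q r i; have [e1 e2] := s1 p q r i; have [e3 e4] := s2 p q r i.
by rewrite !mxE; split; congr (_ + _).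
Qed.

Lemma symmetric_tensorZ c D : symmetric_tensor D -> symmetric_tensor (c *: D).
Proof.
move=> s p q r i; have [e1 e2] := s p q r i.
by rewrite !mxE; split; congr (_ * _).
Qed.

Lemma flatteningD D1 D2 : flattening (D1 + D2) = flattening D1 + flattening D2.
Proof.
apply/matrixP => a i; case/mxvec_indexP: a => x r; case/mxvec_indexP: x => p q.
by rewrite [RHS]mxE !flatteningE mxE.
Qed.

Lemma flatteningZ c D : flattening (c *: D) = c *: flattening D.
Proof.
apply/matrixP => a i; case/mxvec_indexP: a => x r; case/mxvec_indexP: x => p q.
by rewrite [RHS]mxE !flatteningE mxE.
Qed.

Definition cube (l : 'I_m -> k) (w : 'I_tau -> k) : 'M[k]_(m * m, m * tau) :=
  tensor_mx (fun p q r i => l p * l q * l r * w i).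

Definition sum_of_rank1 D := exists s : seq 'M[k]_(m * m, m * tau),
  (forall C, C \in s -> symmetric_tensor C /\ (\rank C <= 1)%N) /\
  D = \sum_(C <- s) C.

Lemma sum_of_rank1_0 : sum_of_rank1 0.
Proof. by exists [::]; rewrite big_nil. Qed.

Lemma sum_of_rank1D D1 D2 :
  sum_of_rank1 D1 -> sum_of_rank1 D2 -> sum_of_rank1 (D1 + D2).
Proof.
move=> [s1 [h1 ->]] [s2 [h2 ->]]; exists (s1 ++ s2); rewrite big_cat.
by split=> // C; rewrite mem_cat => /orP[]; [apply: h1|apply: h2].
Qed.

(** The derivatives of the cube of a linear form [l] are all multiples of the
    square of [l]. *)
Lemma sum_of_rank1_cube c l w : sum_of_rank1 (c *: cube l w).
Proof.
exists [:: c *: cube l w]; split; last by rewrite big_seq1.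
move=> _ /[1!inE] /eqP ->; split.
  apply: symmetric_tensorZ => p q r i; rewrite !tensor_mxE.
  by split; ring.
apply: (leq_trans (mxrank_scale _ _)).
have -> : cube l w =
    (mxvec (\matrix_(p, q) (l p * l q)))^T *m mxvec (\matrix_(r, i) (l r * w i)).
  apply: tensor_mxP => p q r i.
  by rewrite tensor_mxE !mxE big_ord1 !mxE !mxvecE !mxE mulrA.
exact: leq_trans (mxrankM_maxl _ _) (rank_leq_col _).
Qed.

(** The identity
    [6abc = (a+b+c)^3 - (a+b)^3 - (a+c)^3 - (b+c)^3 + a^3 + b^3 + c^3], applied
    to coordinate forms, writes every symmetric tensor in terms of cubes. *)
Lemma polarization D : symmetric_tensor D -> sum_of_rank1 D.
Proof.
move=> symD.
pose d (p : 'I_m) q : k := (q == p)%:R.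
pose w (i : 'I_tau) j : k := (j == i)%:R.
(* The sum runs over all ordered triples, so that each symmetric coefficient is
   met in its six orders; this cancels the factor 6. *)
pose c (x : 'I_m * 'I_m * 'I_m * 'I_tau) : k :=
  D (ix x.1.1.1 x.1.1.2) (ix x.1.2 x.2) / 6%:R.
pose L S := fun p : 'I_m => \sum_(u <- S) d u p.
suff -> : D = \sum_(x : 'I_m * 'I_m * 'I_m * 'I_tau)
  (let: (p, q, r, i) := x in
   c x *: cube (L [:: p; q; r]) (w i) +
   (- c x) *: cube (L [:: p; q]) (w i) + (- c x) *: cube (L [:: p; r]) (w i) +
   (- c x) *: cube (L [:: q; r]) (w i) + c x *: cube (d p) (w i) +
   c x *: cube (d q) (w i) + c x *: cube (d r) (w i)).
  apply: (big_ind sum_of_rank1) => [||[[[p q] r] i] _].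
  - exact: sum_of_rank1_0.
  - exact: sum_of_rank1D.
  - by do !apply: sum_of_rank1D; apply: sum_of_rank1_cube.
apply: tensor_mxP => p q r i; rewrite summxE.
pose t p q r i (x : 'I_m * 'I_m * 'I_m * 'I_tau) : k :=
  D (ix x.1.1.1 x.1.1.2) (ix x.1.2 x.2) * ((p, q, r, i) == x)%:R.
have sum_t p1 q1 r1 i1 : \sum_x t p1 q1 r1 i1 x = D (ix p1 q1) (ix r1 i1).
  rewrite (bigD1 (p1, q1, r1, i1)) //= big1 => [|x /negPf ne].
    by rewrite /t eqxx mulr1 addr0.
  by rewrite /t eq_sym ne mulr0.
have tE p1 q1 r1 i1 p2 q2 r2 i2 : t p1 q1 r1 i1 (p2, q2, r2, i2) =
    D (ix p2 q2) (ix r2 i2) * (d p2 p1 * d q2 q1 * d r2 r1 * w i2 i1).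
  rewrite /t /d /w !xpair_eqE /=.
  by do 4![case: (_ == _)]; rewrite ?(mulr0, mulr1).
transitivity (6%:R^-1 * (\sum_x (t p q r i x + t p r q i x + t q p r i x +
   t q r p i x + t r p q i x + t r q p i x))).
  rewrite !big_split /= !sum_t.
  have s12 p1 q1 r1 : D (ix p1 q1) (ix r1 i) = D (ix q1 p1) (ix r1 i).
    by have [] := symD p1 q1 r1 i.
  have s23 p1 q1 r1 : D (ix p1 q1) (ix r1 i) = D (ix p1 r1) (ix q1 i).
    by have [] := symD p1 q1 r1 i.
  rewrite (s23 p r q) (s12 q p r) (s23 q r p) (s12 q p r).
  rewrite (s12 r p q) (s23 p r q) (s23 r q p) (s12 r p q) (s23 p r q).
  have six : 6%:R != 0 :> k by rewrite (pcharf0P k).1.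
  by apply: (mulfI six); rewrite mulrA divff // mul1r; ring.
rewrite mulr_sumr; apply: eq_bigr => -[[[p1 q1] r1] i1] _.
rewrite !tE /cube !(mxE, mxvecE) /L !big_cons !big_nil /c /=.
ring.
Qed.

(** A discrete intermediate value argument.  Write [H - D0] as a sum of
    symmetric tensors of rank at most one and add them to [D0] one by one, all
    scaled by the same [t].  For generic [t] all the intermediate tensors keep
    linearly independent forms, since [D0] has them at [t = 0], and the last one
    has rank at least [\rank H], its value at [t = 1].  Each step raises the rank
    by at most one, so that the value [n] is taken on the way. *)
Lemma exists_symmetric_tensor_rank D0 H (n : nat) :
    symmetric_tensor D0 -> row_full (flattening D0) -> (\rank D0 <= n)%N ->
    symmetric_tensor H -> (n <= \rank H)%N ->
  exists D, [/\ symmetric_tensor D, row_full (flattening D) & \rank D = n].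
Proof.
move=> symD0 fullD0 rD0 symH rH.
have [s [sP Es]] : sum_of_rank1 (H - D0).
  by apply/polarization/symmetric_tensorD; rewrite // -scaleN1r;
     apply: symmetric_tensorZ.
pose S j := \sum_(C <- take j s) C.
have symS j : symmetric_tensor (S j).
  rewrite /S big_seq; apply: (big_ind (@symmetric_tensor k m tau)).
  - by move=> p q r i; rewrite !mxE.
  - exact: symmetric_tensorD.
  - by move=> C /mem_take /sP[].
have [P [P0 HP]] := generic_rank D0 (S (size s)) 1.
have /choice[Q HQ] j := generic_rank (flattening D0) (flattening (S j)) 0.
have : P * \prod_(j < (size s).+1) Q j != 0.
  by rewrite mulf_neq0 //; apply/prodf_neq0 => j _; have [] := HQ j.
move=> /(exists_nonroot char0)[t]; rewrite hornerM mulf_eq0 negb_or.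
rewrite horner_prod => /andP[Pt /prodf_neq0 Qt].
have [||j js rj] := @discrete_ivt (fun j => \rank (D0 + t *: S j)%R) (size s) n.
- move=> j js; rewrite /S (take_nth 0) // -cats1 big_cat big_seq1 scalerDr addrA.
  apply: leq_trans (mxrank_add _ _) _; rewrite -addn1 leq_add2l.
  apply: leq_trans (mxrank_scale _ _) _.
  by have [] := sP _ (mem_nth 0 js).
- rewrite /S take0 big_nil scaler0 addr0 rD0 (leq_trans rH) //.
  have := HP _ Pt; rewrite /S take_size -Es scale1r addrC subrK; apply.
exists (D0 + t *: S j); split=> //.
  by apply: symmetric_tensorD => //; apply: symmetric_tensorZ.
have [_ /(_ t)] := HQ j.
rewrite -ltnS in js; rewrite (Qt (Ordinal js) isT) => /(_ isT).
rewrite scale0r addr0 (eqP fullD0) flatteningD flatteningZ => le_tau.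
by rewrite /row_full eqn_leq rank_leq_col.
Qed.

End Polarization.

(** * Forms with many derivatives *)

Section CyclicTensor.
Local Open Scope ring_scope.
Variables (k : fieldType) (m' tau : nat).
Local Notation m := m'.+1.
Local Notation ix := (@mxvec_index _ _).
Implicit Types p q r : 'I_m.

(** With indices modulo [m], the [i]-th form is the sum over [j] of the divided
    power monomials [x_j^2 x_(j+i)].  Its derivative in the direction [r] is
    [x_r x_(r+i) + x_(r-i)^2], or [x_r^2] when [i] vanishes modulo [m]: up to
    squares, which the form with [i = 0] provides, it is a single monomial. *)
Definition cyclic_tensor : 'M[k]_(m * m, m * tau) :=
  tensor_mx (fun p q r i =>
    [|| (p == q) && (r == p + inZp i),
        (p == r) && (q == p + inZp i) |
        (q == r) && (p == q + inZp i)]%:R).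

Lemma cyclic_tensor_sym : symmetric_tensor cyclic_tensor.
Proof.
move=> p q r i; rewrite !tensor_mxE; split; congr (_ %:R); congr nat_of_bool.
  have [->|_] := eqVneq p q; rewrite //=.
  by rewrite orbC.
have [->|_] := eqVneq q r; rewrite //=.
by rewrite !orbF orbC.
Qed.

(** As long as [i] stays below half of [m], a pair of distinct indices is
    [{r, r + i}] for at most one pair [(r, i)]; hence all derivatives are linearly
    independent. *)
Lemma cyclic_tensor_free :
  (tau.*2 <= m.+1)%N -> row_free cyclic_tensor^T.
Proof.
move=> tau_le; apply: inj_row_free => v vH0.
have eq0 p q : \sum_r \sum_i v 0 (ix r i) * cyclic_tensor (ix p q) (ix r i) = 0.
  have /rowP/(_ (ix p q)) := vH0.
  rewrite [LHS]mxE [RHS]mxE sum_mxvec_index; apply: etrans.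
  by apply: eq_bigr => r _; apply: eq_bigr => i _; rewrite [in RHS]mxE.
(* Only [(r, i) = (p, i)] contributes to the entry [(p, p + i)]: the other
   candidate [(p + i, j)] would need [i + j] to be [0] modulo [m]. *)
have v_neq0 p (i : 'I_tau) : (0 < i)%N -> v 0 (ix p i) = 0.
  move=> i_gt0; have := eq0 p (p + inZp i).
  rewrite (bigD1 p) //= [X in X + _](bigD1 i) //=.
  have ne_p : p != p + inZp i.
    rewrite -[X in X == _]addr0 (inj_eq (addrI p)) -val_eqE /=.
    by rewrite modn_small; have := ltn_ord i; lia.
  rewrite tensor_mxE eqxx (negPf ne_p) /= eqxx mulr1.
  rewrite big1 => [|j ji]; last first.
    rewrite tensor_mxE eqxx (negPf ne_p) /= (inj_eq (addrI p)) -val_eqE /=.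
    rewrite !modn_small; try by have := ltn_ord i; have := ltn_ord j; lia.
    rewrite eq_sym (_ : (val j == val i) = false); last first.
      by apply/negbTE; rewrite val_eqE.
    by rewrite eq_sym (negPf ne_p) mulr0.
  rewrite big1 => [|r rp]; first by rewrite !addr0.
  rewrite big1 // => j _; rewrite tensor_mxE (negPf ne_p) [p == r]eq_sym (negPf rp) /=.
  suff /negPf-> : p != p + inZp i + inZp j by rewrite andbF mulr0.
  rewrite -addrA -[X in X == _]addr0 (inj_eq (addrI p)) -val_eqE /=.
  by rewrite modnDm modn_small; have := ltn_ord i; have := ltn_ord j; lia.
(* The diagonal entries [(p, p)] now involve only the squares [x_p^2]. *)
apply/rowP => a; case/mxvec_indexP: a => p i; rewrite mxE.
have [i0|] := posnP i; last exact: v_neq0.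
have := eq0 p p; rewrite (bigD1 p) //= [X in X + _](bigD1 i) //=.
have inZp0 (j : 'I_tau) : val j = 0 -> inZp j = 0 :> 'I_m.
  by move=> j0; apply/val_inj; rewrite /= j0 mod0n.
rewrite tensor_mxE inZp0 // eqxx addr0 eqxx mulr1 big1 => [|j ji]; last first.
  rewrite v_neq0 ?mul0r //; move: ji; rewrite -val_eqE /=; lia.
rewrite big1 => [|r rp]; first by rewrite !addr0.
rewrite big1 // => j _; have [j0|j_gt0] := posnP j; last by rewrite v_neq0 ?mul0r.
by rewrite tensor_mxE inZp0 // eqxx addr0 eqxx [p == r]eq_sym (negPf rp) /= mulr0.
Qed.

(** Once [i] reaches half of [m], each pair [{p, q}] is [{r, r + i}] for
    some [r] and [i], because one of the residues [p - q] and [q - p] is small;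
    the derivatives then span all quadratic forms. *)
Lemma cyclic_tensor_full (s : 'rV[k]_(m * m)) :
    2%:R != 0 :> k -> (m.+1 < tau.*2)%N ->
  (forall p q, s 0 (ix p q) = s 0 (ix q p)) -> (s <= cyclic_tensor^T)%MS.
Proof.
move=> two tau_gt sym_s.
pose E p q : 'rV[k]_(m * m) := mxvec (delta_mx p q).
pose W := cyclic_tensor^T.
have rowW r (i : 'I_tau) p q :
    row (ix r i) W 0 (ix p q) = cyclic_tensor (ix p q) (ix r i).
  by rewrite [LHS]mxE [LHS]mxE.
have tau_gt0 : (0 < tau)%N by lia.
have Ediag p : (E p p <= W)%MS.
  suff <- : row (ix p (Ordinal tau_gt0)) W = E p p by apply: row_sub.
  have z0 : inZp (Ordinal tau_gt0) = 0 :> 'I_m by apply/val_inj; rewrite /= mod0n.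
  apply/rowP => a; case/mxvec_indexP: a => p1 q1.
  rewrite rowW tensor_mxE z0 !addr0 mxvecE mxE.
  have [->|] := eqVneq p1 q1; first by rewrite eq_sym; case: eqP.
  rewrite !andbF /=; have [->|_] := eqVneq p1 p; rewrite //= eq_sym.
  by move=> /negPf->.
have Eoff r (i : 'I_tau) : inZp i != 0 :> 'I_m ->
    ((E r (r + inZp i) + E (r + inZp i) r)%R <= W)%MS.
  move=> i0; pose a : 'I_m := inZp i.
  suff -> : E r (r + a) + E (r + a) r = row (ix r i) W - E (r - a) (r - a).
    by rewrite addmx_sub ?row_sub // eqmx_opp Ediag.
  apply/rowP => x; case/mxvec_indexP: x => p q.
  rewrite [RHS]mxE rowW tensor_mxE -/a [X in _ = _ + X]mxE [LHS]mxE !mxvecE !mxE.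
  have ne_a (x : 'I_m) : (x == x + a) = false.
    by rewrite -[X in X == _]addr0 (inj_eq (addrI x)) eq_sym; apply/negbTE.
  have [<-|pq] := eqVneq p q; rewrite /=.
    rewrite ne_a !andbF !orbF andbb [p == r - a]eq_sym subr_eq subrr.
    by have [->|] := eqVneq p r; rewrite ?ne_a ?andbF addr0.
  have -> : (p == r - a) && (q == r - a) = false.
    by case: eqP => //= pE; apply/eqP => qE; rewrite pE qE eqxx in pq.
  rewrite subr0; have [<-|_] := eqVneq p r.
    by rewrite [q == p]eq_sym (negPf pq) andbF orbF addr0.
  have [->|_] := eqVneq q r; first by rewrite andbT add0r.
  by rewrite andbF add0r.
have Esym p q : ((E p q + E q p)%R <= W)%MS.
  have [->|pq] := eqVneq p q; first by rewrite addmx_sub.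
  have [lt_d|ge_d] := ltnP (q - p)%R tau.
    have := Eoff p (Ordinal lt_d).
    rewrite (_ : inZp _ = q - p); last exact: valZpK.
    rewrite [p + _]addrC subrK subr_eq0.
    by rewrite eq_sym; apply.
  (* [q - p] and [p - q] add up to [m] as representatives, and [tau > m / 2]. *)
  have lt_d : ((p - q)%R < tau)%N.
    rewrite -opprB; move: (q - p)%R ge_d => d ge_d.
    by rewrite /= modn_small; have := ltn_ord d; lia.
  rewrite addrC; have := Eoff q (Ordinal lt_d).
  rewrite (_ : inZp _ = p - q); last exact: valZpK.
  by rewrite [q + _]addrC subrK subr_eq0; apply.
have -> : s = 2%:R^-1 *: \sum_p \sum_q s 0 (ix p q) *: (E p q + E q p).
  have Es : \sum_p \sum_q s 0 (ix p q) *: E p q = s.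
    rewrite [RHS]row_sum_delta sum_mxvec_index.
    by do 2![apply: eq_bigr => ? _]; rewrite /E mxvec_delta.
  have Es' : \sum_p \sum_q s 0 (ix p q) *: E q p = s.
    rewrite -[RHS]Es exchange_big; apply: eq_bigr => p _.
    by apply: eq_bigr => q _; rewrite sym_s.
  under eq_bigr do under eq_bigr do rewrite scalerDr.
  under eq_bigr do rewrite big_split /=.
  rewrite big_split /= Es Es' -mulr2n -scaler_nat scalerA mulVf //.
  by rewrite scale1r.
apply: scalemx_sub; apply: summx_sub => p _; apply: summx_sub => q _.
by apply: scalemx_sub.
Qed.

(** The derivatives are either linearly independent, and there are [m * tau] of
    them, or they span the space of quadratic forms, which contains the columns
    of [mu]. *)
Lemma cyclic_tensor_rank (n : nat) (mu : 'M[k]_(m * m, n)) :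
    2%:R != 0 :> k -> (n <= m * tau)%N -> row_full mu ->
    (forall p q, row (ix p q) mu = row (ix q p) mu) ->
  (n <= \rank cyclic_tensor)%N.
Proof.
move=> two n_le /eqP rk_mu sym_mu; rewrite -mxrank_tr.
have [le_tau|lt_tau] := leqP tau.*2 m.+1.
  by rewrite (eqP (cyclic_tensor_free le_tau)).
rewrite -rk_mu -[X in (X <= _)%N]mxrank_tr.
apply: mxrankS; apply/row_subP => c; apply: cyclic_tensor_full => // p q.
by have /rowP/(_ c) := sym_mu p q; rewrite !mxE.
Qed.
End CyclicTensor.

(** * Finite-dimensional local algebras *)

Section Subspaces.
Local Open Scope ring_scope.
Local Open Scope classical_set_scope.
Variables (k : fieldType) (V : vectType k).

Lemma subspace_vspace (I : set V) :
    I 0 -> (forall a x y, I x -> I y -> I (a *: x + y)) ->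
  exists U : {vspace V}, forall x, I x <-> x \in U.
Proof.
move=> I0 IL.
(* [U] is taken of maximal dimension among the subspaces contained in [I]. *)
pose P d := `[< exists U : {vspace V}, \dim U = d /\ forall x, x \in U -> I x >].
have P0 : exists d, P d.
  by exists 0; apply/asboolP; exists 0%VS; rewrite dimv0; split=> // x /[!memv0]/eqP->.
have Pmax d : P d -> (d <= \dim {:V})%N.
  by move=> /asboolP[U [<- _]]; apply/dimvS/subvf.
case: (ex_maxnP P0 Pmax) => d /asboolP[U [dimU UI]] maxU.
exists U => x; split=> [Ix|/UI//].
have PUx : P (\dim (U + <[x]>)).
  apply/asboolP; exists (U + <[x]>)%VS; split=> // _ /memv_addP[u uU [_ /vlineP[a ->] ->]].
  by rewrite addrC; apply: IL => //; apply: UI.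
have /eqP -> : U == (U + <[x]>)%VS by rewrite eqEdim addvSl dimU maxU.
exact: subvP (addvSr _ _) _ (memv_line x).
Qed.

(** The dot product of coordinates on [U], precomposed with a projection onto
    [U]; this works in every characteristic. *)
Lemma symmetric_form_on (U : {vspace V}) : exists q : V -> V -> k,
  [/\ forall v w, q v w = q w v,
      forall u a v w, q u (a *: v + w) = a * q u v + q u w &
      forall v, v \in U -> (forall w, w \in U -> q v w = 0) -> v = 0].
Proof.
pose c i v := coord (vbasis U) i (projv U v).
exists (fun v w => \sum_i c i v * c i w); split.
- by move=> v w; apply: eq_bigr => i _; rewrite mulrC.
- move=> u a v w; rewrite mulr_sumr -big_split; apply: eq_bigr => i _ /=.
  by rewrite /c !linearP /=; ring.
move=> v vU q0; rewrite (coord_vbasis vU) big1 // => i _.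
have bU (j : 'I_(\dim U)) : (vbasis U)`_j \in U by rewrite vbasis_mem ?mem_nth ?size_tuple.
have := q0 _ (bU i); rewrite (bigD1 i) //= big1 => [|j ji]; last first.
  rewrite /c [X in _ * coord _ _ X]projv_id // coord_free ?(basis_free (vbasisP U)) //.
  by rewrite eq_sym (negPf ji) mulr0.
rewrite /c !projv_id // coord_free ?(basis_free (vbasisP U)) // eqxx mulr1 addr0 => ->.
by rewrite scale0r.
Qed.

End Subspaces.

Section LocalCriterion.
Local Open Scope classical_set_scope.
Local Open Scope ring_scope.
Variables (k : fieldType) (A : comAlgType k).

Lemma artinian_of_findim (V : vectType k) (h : {linear A -> V}) :
  injective h -> artinian_ring A.
Proof.
move=> h_inj I idI Idec.
have /choice[U UP] i : exists U : {vspace V}, forall x, (h @` I i) x <-> x \in U.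
  apply: subspace_vspace.
    by exists 0; [have [] := idI i|rewrite linear0].
  move=> a _ _ [x Ix <-] [y Iy <-]; exists (a *: x + y); last by rewrite linearP.
  by apply: idealD => //; apply: idealZ.
have IU i x : I i x <-> h x \in U i.
  rewrite -(UP i); split=> [Ix|[y Iy /h_inj <-] //]; by exists x.
have Ule i j : (i <= j)%N -> (U j <= U i)%VS.
  move=> /subnK <-; elim: (j - i)%N => [|d IHd]; first exact: subvv.
  apply: subv_trans IHd; apply/subvP => x /(UP _) [y Iy <-].
  by apply/(UP _); exists y => //; apply: Idec.
pose P d := `[< exists i, \dim (U i) = d >].
have P0 : exists d, P d by exists (\dim (U 0)); apply/asboolP; exists 0.
case: (ex_minnP P0) => d /asboolP[N dimN] minN.
exists N => i Ni; have /eqP UiN : U i == U N.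
  by rewrite eqEdim Ule //= dimN minN //; apply/asboolP; exists i.
by apply/seteqP; split=> x; rewrite !IU UiN.
Qed.

(** An element [c - u] with [c] a nonzero scalar and [u] in the nilpotent ideal
    [M] divides [c^s - u^s = c^s], so every proper ideal lies inside [M]. *)
Lemma nilpotent_artinian_local (M : set A) s :
    artinian_ring A -> is_ideal M -> M <> setT -> ideal_pow M s = [set 0] ->
    (forall a, exists c : k, M (a - c%:A)) ->
  artinian_local M.
Proof.
move=> artA idM M_proper Ms0 resM.
have ideal_sub (I : set A) : is_ideal I -> I <> setT -> I `<=` M.
  move=> idI I_proper x Ix; have [c Mxc] := resM x.
  have [c0|c0] := eqVneq c 0; first by rewrite c0 scale0r subr0 in Mxc.
  case: I_proper; apply/seteqP; split=> // y _.
  have [_ _ IM] := idI.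
  pose u := c%:A - x.
  have Mu : M u by rewrite /u -opprB -scaleN1r; apply: idealZ.
  have us0 : u ^+ s = 0.
    suff : ideal_pow M s (u ^+ s) by rewrite Ms0.
    by elim: s {Ms0} => [|j IHj] //; rewrite exprS; apply: mem_ideal_mul.
  have : I (c%:A ^+ s - u ^+ s).
    rewrite subrXX /u opprB addrC subrK mulrC; exact: IM.
  rewrite us0 subr0 => Ics.
  have := IM (y * (c ^- s)%:A) _ Ics.
  rewrite -mulrA -[c%:A ^+ s]/((in_alg A c) ^+ s) -rmorphXn -[_%:A]/(in_alg A _).
  by rewrite -rmorphM mulVf ?expf_neq0 // rmorph1 mulr1.
split=> //.
- split=> // I idI MI; have [->|I_proper] := pselect (I = setT); first by right.
  by left; apply/seteqP; split=> //; apply: ideal_sub.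
- move=> I [idI I_proper maxI].
  by have [->|] := maxI M idM (ideal_sub I idI I_proper).
Qed.

Lemma quo_dim_linear (I J : set A) d (f : 'rV[k]_d -> A) :
    (forall a u v, f (a *: u + v) = a *: f u + f v) ->
    (forall u, I (f u)) -> (forall x, I x -> exists u, J (x - f u)) ->
    (forall u, J (f u) -> u = 0) ->
  quo_dim I J d.
Proof.
move=> f_lin fI f_gen f_inj.
have f0 : f 0 = 0.
  by have := f_lin (-1) 0 0; rewrite scaler0 addr0 scaleN1r addNr.
have fE c : \sum_i c i *: f 'e_i = f (\row_i c i).
  rewrite [X in _ = f X]row_sum_delta (big_morph f (id1 := 0) (op1 := +%R)) //.
    apply: eq_bigr => i _; rewrite mxE.
    by have := f_lin (c i) 'e_i 0; rewrite !addr0 f0 addr0 => ->.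
  by move=> u v; have := f_lin 1 u v; rewrite !scale1r.
exists (fun i => f 'e_i); split=> // [x /f_gen[u Ju]|c].
  exists (u 0); rewrite fE (_ : \row_i _ = u) //.
  by apply/rowP => i; rewrite mxE.
by rewrite fE => /f_inj/rowP c0 i; have := c0 i; rewrite !mxE.
Qed.

End LocalCriterion.

(** * The algebra of a graded product *)

Section TruncatedAlgebra.
Local Open Scope ring_scope.
Local Open Scope classical_set_scope.

(** Data for a product on [k + V + U + T], with [V], [U], [T] in degrees 1, 2, 3:
    [mul11] and [mul12] are its homogeneous parts, while [cor11] is a correction
    of degree one, sending products of two vectors of [V] to the top degree.
    Associativity constrains [mul11] and [mul12] only, through [mul12A], since
    the correction is killed by further products; it makes the algebra local
    without being graded, which is what allows [h]-vectors that no graded level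
    algebra has. *)
Record graded_product (k : fieldType) (m n tau : nat) := GradedProduct {
  mul11 : 'rV[k]_m -> 'rV[k]_m -> 'rV[k]_n;
  cor11 : 'rV[k]_m -> 'rV[k]_m -> 'rV[k]_tau;
  mul12 : 'rV[k]_m -> 'rV[k]_n -> 'rV[k]_tau;
  mul11C : forall v w, mul11 v w = mul11 w v;
  mul11P : forall u a v w, mul11 u (a *: v + w) = a *: mul11 u v + mul11 u w;
  cor11C : forall v w, cor11 v w = cor11 w v;
  cor11P : forall u a v w, cor11 u (a *: v + w) = a *: cor11 u v + cor11 u w;
  mul12Pl : forall b a v w, mul12 (a *: v + w) b = a *: mul12 v b + mul12 w b;
  mul12Pr : forall u a v w, mul12 u (a *: v + w) = a *: mul12 u v + mul12 u w;
  mul12A : forall u v w, mul12 u (mul11 v w) = mul12 w (mul11 u v) }.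

Variables (k : fieldType) (m n tau : nat).

Section Bilinear.
Variable D : graded_product k m n tau.

Lemma linear_parts (V W : lmodType k) (f : V -> W) :
    (forall a v w, f (a *: v + w) = a *: f v + f w) ->
  ((forall v w, f (v + w) = f v + f w) * (forall a v, f (a *: v) = a *: f v)) *
  (f 0 = 0).
Proof.
move=> fP; have f0 : f 0 = 0.
  by have := fP (-1) 0 0; rewrite scaler0 addr0 scaleN1r addNr.
by split=> //; split=> [v w|a v];
  [have := fP 1 v w|have := fP a v 0]; rewrite ?scale1r // f0 !addr0.
Qed.

Definition mul11r u := linear_parts (mul11P D u).
Definition cor11r u := linear_parts (cor11P D u).
Definition mul12r u := linear_parts (mul12Pr D u).

Lemma mul12l b : (forall v w, mul12 D (v + w) b = mul12 D v b + mul12 D w b) *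
  (forall a v, mul12 D (a *: v) b = a *: mul12 D v b) * (mul12 D 0 b = 0).
Proof. exact: linear_parts (mul12Pl D b). Qed.

Lemma mul11l b : (forall v w, mul11 D (v + w) b = mul11 D v b + mul11 D w b) *
  (forall a v, mul11 D (a *: v) b = a *: mul11 D v b) * (mul11 D 0 b = 0).
Proof. by split; [split=> *|]; rewrite !(mul11C D _ b) mul11r. Qed.

Lemma cor11l b : (forall v w, cor11 D (v + w) b = cor11 D v b + cor11 D w b) *
  (forall a v, cor11 D (a *: v) b = a *: cor11 D v b) * (cor11 D 0 b = 0).
Proof. by split; [split=> *|]; rewrite !(cor11C D _ b) cor11r. Qed.

Definition bilE := (mul11r, cor11r, mul12r, mul12l, mul11l, cor11l).
End Bilinear.

Definition truncated_algebra (D : graded_product k m n tau) : Type :=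
  (k^o * 'rV[k]_m * 'rV[k]_n * 'rV[k]_tau)%type.

Variable D : graded_product k m n tau.
Local Notation R := (truncated_algebra D).

HB.instance Definition _ :=
  GRing.Lmodule.copy R (k^o * 'rV[k]_m * 'rV[k]_n * 'rV[k]_tau)%type.

Definition elt (c : k) (v : 'rV[k]_m) (b : 'rV[k]_n) (t : 'rV[k]_tau) : R :=
  (c, v, b, t).

Definition trunc_mul (x y : R) : R :=
  let: (c, v, b, t) := x in let: (d, w, e, s) := y in
  elt (c * d) (c *: w + d *: v) (c *: e + d *: b + mul11 D v w)
    (c *: s + d *: t + cor11 D v w + mul12 D v e + mul12 D w b).

Lemma eltP c v b t d w e s :
  c = d -> v = w -> b = e -> t = s -> elt c v b t = elt d w e s.
Proof. by move=> -> -> -> ->. Qed.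

Lemma trunc_mulC : commutative trunc_mul.
Proof.
move=> [[[c v] b] t] [[[d w] e] s]; apply: eltP.
- exact: mulrC.
- exact: addrC.
- by rewrite mul11C [c *: _ + _]addrC.
- by rewrite cor11C [c *: _ + _]addrC addrAC.
Qed.

Lemma trunc_mulA : associative trunc_mul.
Proof.
move=> [[[c v] b] t] [[[d w] e] s] [[[f u] g] r]; apply: eltP.
- exact: mulrA.
- by apply/rowP => i; rewrite !mxE; ring.
- by rewrite !bilE; apply/rowP => i; rewrite !mxE; ring.
rewrite !bilE (mul12A D v w u).
by apply/rowP => i; rewrite !mxE; ring.
Qed.

Lemma trunc_mul1 : left_id (elt 1 0 0 0) trunc_mul.
Proof.
by move=> [[[c v] b] t]; apply: eltP; rewrite ?mul1r // ?bilE ?scale1r ?scaler0 ?addr0.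
Qed.

Lemma trunc_mulD : left_distributive trunc_mul +%R.
Proof.
move=> [[[c v] b] t] [[[d w] e] s] [[[f u] g] r]; apply: eltP => /=.
- exact: mulrDl.
- by apply/rowP => i; rewrite !mxE; ring.
- by rewrite !bilE; apply/rowP => i; rewrite !mxE; ring.
- by rewrite !bilE; apply/rowP => i; rewrite !mxE; ring.
Qed.

Lemma trunc_1_neq0 : elt 1 0 0 0 != 0.
Proof. by apply/eqP => -[/eqP]; rewrite oner_eq0. Qed.

HB.instance Definition _ := GRing.Zmodule_isComNzRing.Build R
  trunc_mulA trunc_mulC trunc_mul1 trunc_mulD trunc_1_neq0.

Lemma scale_elt a c v b t :
  a *: elt c v b t = elt (a * c) (a *: v) (a *: b) (a *: t).
Proof. by []. Qed.

Lemma mul_elt c v b t d w e s : elt c v b t * elt d w e s =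
  elt (c * d) (c *: w + d *: v) (c *: e + d *: b + mul11 D v w)
    (c *: s + d *: t + cor11 D v w + mul12 D v e + mul12 D w b).
Proof. by []. Qed.

Lemma trunc_scaleAl (a : k) (x y : R) : a *: (x * y) = (a *: x) * y.
Proof.
case: x y => [[[c v] b] t] [[[d w] e] s].
change (a *: (elt c v b t * elt d w e s) = (a *: elt c v b t) * elt d w e s).
rewrite (scale_elt a c v b t) !mul_elt scale_elt; apply: eltP.
- exact: mulrA.
- by apply/rowP => i; rewrite !mxE; ring.
- by rewrite !bilE; apply/rowP => i; rewrite !mxE; ring.
- by rewrite !bilE; apply/rowP => i; rewrite !mxE; ring.
Qed.

HB.instance Definition _ := GRing.Lmodule_isLalgebra.Build k R trunc_scaleAl.
HB.instance Definition _ := GRing.Lalgebra_isComAlgebra.Build k R.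

Lemma add_elt c v b t d w e s :
  elt c v b t + elt d w e s = elt (c + d) (v + w) (b + e) (t + s).
Proof. by []. Qed.

Lemma opp_elt c v b t : - elt c v b t = elt (- c) (- v) (- b) (- t).
Proof. by []. Qed.

Hypothesis mul11_gen : forall P : 'rV[k]_n -> Prop,
  P 0 -> (forall b b', P b -> P b' -> P (b + b')) ->
  (forall v w, P (mul11 D v w)) -> forall b, P b.
Hypothesis mul12_gen : forall P : 'rV[k]_tau -> Prop,
  P 0 -> (forall t t', P t -> P t' -> P (t + t')) ->
  (forall u v w, P (mul12 D u (mul11 D v w))) -> forall t, P t.

Definition trunc_max : set R := [set x | x.1.1.1 = 0].
Local Notation M := trunc_max.

Lemma trunc_max_ideal : is_ideal M.
Proof.
split=> //.
- by move=> [[[c v] b] t] [[[d w] e] s]; rewrite /M /= => -> ->; rewrite add0r.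
- by move=> [[[c v] b] t] [[[d w] e] s]; rewrite /M /= => ->; rewrite mulr0.
Qed.

Let idP j := ideal_pow_ideal j trunc_max_ideal.

Lemma trunc_pow1 : ideal_pow M 1 = M.
Proof. exact: ideal_pow1 trunc_max_ideal. Qed.

(** Triple products of vectors of [V] have no component along the correction, so
    they give the top degree directly; degree two is reached afterwards, modulo
    the top degree. *)
Lemma pow3_elt t : ideal_pow M 3 (elt 0 0 0 t).
Proof.
move: t; apply: mul12_gen => [|t t' Pt Pt'|u v w].
- by have [] := idP 3.
- by have := idealD (idP 3) Pt Pt'; rewrite add_elt !addr0.
have in1 x : ideal_pow M 1 (elt 0 x 0 0) by rewrite trunc_pow1.
have := mem_ideal_powD (i := 1) (j := 2) trunc_max_ideal (in1 u)
  (mem_ideal_powD (i := 1) (j := 1) trunc_max_ideal (in1 v) (in1 w)).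
by rewrite !mul_elt !mulr0 !bilE !scale0r ?(addr0, add0r).
Qed.

Lemma trunc_pow2 : ideal_pow M 2 = [set x : R | x.1.1.1 = 0 /\ x.1.1.2 = 0].
Proof.
apply/seteqP; split.
  apply: ideal_mul_min => //.
  - by move=> [[[c v] b] t] [[[d w] e] s] /= [-> ->] [-> ->]; rewrite !addr0.
  - move=> [[[c v] b] t] [[[d w] e] s]; rewrite -/(ideal_pow M 1) trunc_pow1.
    by rewrite /M /= => -> ->; rewrite mulr0 !scale0r addr0.
have bin b : ideal_pow M 2 (elt 0 0 b 0).
  move: b; apply: mul11_gen => [|b b' Pb Pb'|v w].
  - by have [] := idP 2.
  - by have := idealD (idP 2) Pb Pb'; rewrite add_elt !addr0.
  have in1 x : ideal_pow M 1 (elt 0 x 0 0) by rewrite trunc_pow1.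
  have := idealB (idP 2)
    (mem_ideal_powD (i := 1) (j := 1) trunc_max_ideal (in1 v) (in1 w))
    (ideal_powS trunc_max_ideal (pow3_elt (cor11 D v w))).
  by rewrite mul_elt opp_elt add_elt !mulr0 !bilE !scale0r ?(addr0, add0r, oppr0) subrr.
move=> [[[c v] b] t] /= [-> ->].
have := idealD (idP 2) (bin b) (ideal_powS trunc_max_ideal (pow3_elt t)).
by rewrite add_elt ?(addr0, add0r).
Qed.

Lemma trunc_pow3 :
  ideal_pow M 3 = [set x : R | [/\ x.1.1.1 = 0, x.1.1.2 = 0 & x.1.2 = 0]].
Proof.
apply/seteqP; split.
  apply: ideal_mul_min => //.
  - move=> [[[c v] b] t] [[[d w] e] s] /= [-> -> ->] [-> -> ->].
    by rewrite !addr0.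
  - move=> [[[c v] b] t] [[[d w] e] s]; rewrite -/(ideal_pow M 2) trunc_pow2.
    by rewrite /M /= => -> [-> ->]; rewrite mulr0 !bilE !scale0r ?addr0.
by move=> [[[c v] b] t] /= [-> -> ->]; apply: pow3_elt.
Qed.

Lemma trunc_pow4 : ideal_pow M 4 = [set 0].
Proof.
apply/seteqP; split=> [|_ ->]; last by have [] := idP 4.
apply: ideal_mul_min => //.
- by move=> _ _ -> ->; rewrite addr0.
- move=> [[[c v] b] t] [[[d w] e] s]; rewrite -/(ideal_pow M 3) trunc_pow3.
  rewrite /M /= => -> [-> -> ->].
  change (elt 0 v b t * elt 0 0 0 s = elt 0 0 0 0).
  by rewrite mul_elt mulr0 !bilE !scale0r ?addr0.
Qed.

Lemma trunc_artinian_local : artinian_local M.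
Proof.
apply: (nilpotent_artinian_local (s := 4)).
- pose h (x : R) : (k^o * 'rV[k]_m * 'rV[k]_n * 'rV[k]_tau)%type := x.
  have h_lin : linear h by [].
  pose hL := GRing.isLinear.Build _ _ _ _ h h_lin.
  pose hl : {linear R -> _} := HB.pack h hL.
  by apply: (@artinian_of_findim _ _ _ hl) => x y.
- exact: trunc_max_ideal.
- by move=> /seteqP[_ /(_ (1 : R) I)]; rewrite /M /= => /eqP; rewrite oner_eq0.
- exact: trunc_pow4.
- move=> [[[c v] b] t]; exists c; rewrite /M.
  by rewrite -[1]/(elt 1 0 0 0) scale_elt /= mulr1 subrr.
Qed.

Lemma trunc_socle_degree : (0 < tau)%N -> socle_degree M 3.
Proof.
move=> tau_gt0; split; last exact: trunc_pow4.
move=> p3; have : ideal_pow M 3 (elt 0 0 0 (const_mx 1)) by apply: pow3_elt.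
rewrite p3 => -[/rowP/(_ (Ordinal tau_gt0))/eqP].
by rewrite !mxE oner_eq0.
Qed.

Lemma trunc_h_vector : (0 < tau)%N -> h_vector M [:: 1; m; n; tau]%N.
Proof.
move=> tau_gt0; exists 3; split=> //; first exact: trunc_socle_degree.
case=> [|[|[|[|//]]]] _; rewrite /hilbert_fun /nth.
- rewrite trunc_pow1.
  apply: (quo_dim_linear (f := fun u : 'rV_1 => elt (u 0 0) 0 0 0)) => //.
  + move=> a u v; rewrite scale_elt add_elt !scaler0 !addr0.
    by apply: eltP; rewrite // !mxE.
  + move=> [[[c v] b] t] _; exists c%:M; rewrite /M /= mxE eqxx mulr1n.
    by rewrite subrr.
  + by move=> u; rewrite /M /= => u0; apply/rowP => i; rewrite ord1 u0 mxE.
- rewrite trunc_pow1 trunc_pow2.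
  apply: (quo_dim_linear (f := fun u : 'rV_m => elt 0 u 0 0)) => //.
  + by move=> a u v; rewrite scale_elt add_elt mulr0 !scaler0 !addr0.
  + move=> [[[c v] b] t]; rewrite /M /= => ->; exists v.
    by rewrite /= !subrr.
  + by move=> u /= [].
- rewrite trunc_pow2 trunc_pow3.
  apply: (quo_dim_linear (f := fun u : 'rV_n => elt 0 0 u 0)) => //.
  + by move=> a u v; rewrite scale_elt add_elt mulr0 !scaler0 !addr0.
  + by move=> [[[c v] b] t] /= [-> ->]; exists b; rewrite /= !subrr.
  + by move=> u /= [].
- rewrite trunc_pow3 trunc_pow4.
  apply: (quo_dim_linear (f := fun u : 'rV_tau => elt 0 0 0 u)) => //.
  + by move=> a u v; rewrite scale_elt add_elt mulr0 !scaler0 !addr0.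
  + by move=> [[[c v] b] t] /= [-> -> ->]; exists t; apply: subrr.
  + by move=> u [].
Qed.

(** Products with [V] suffice to detect the socle: the hypothesis says that an
    element of the maximal ideal killed by [V] has top degree. *)
Lemma trunc_level : (0 < tau)%N ->
    (forall v b, (forall w, mul11 D v w = 0 /\ cor11 D v w + mul12 D w b = 0) ->
       v = 0 /\ b = 0) ->
  level M.
Proof.
move=> tau_gt0 nondeg; have sd3 := trunc_socle_degree tau_gt0.
have [s [sd _ hf]] := trunc_h_vector tau_gt0.
have s3 := socle_degree_unique trunc_max_ideal sd sd3.
subst s; exists 3, tau.
have socE : socle M = ideal_pow M 3.
  apply/seteqP; split; last first.
    move=> x x3 y; rewrite -{1}trunc_pow1 => y1.
    have := mem_ideal_powD (i := 3) (j := 1) trunc_max_ideal x3 y1.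
    by rewrite trunc_pow4.
  move=> [[[c v] b] t] soc; rewrite trunc_pow3 /=.
  have c0 : c = 0.
    have /(congr1 snd)/= := soc (elt 0 0 0 (const_mx 1)) erefl.
    move=> /rowP/(_ (Ordinal tau_gt0)).
    by rewrite !bilE scale0r !mxE mulr1 !addr0.
  have [v0 b0] : v = 0 /\ b = 0.
    apply: nondeg => w; have soc_w := soc (elt 0 w 0 0) erefl.
    split; [have := congr1 (fun x : R => x.1.2) soc_w | have := congr1 snd soc_w];
      by rewrite /= c0 ?bilE ?scale0r ?scaler0 ?add0r ?addr0.
  by [].
split=> //; rewrite socE -trunc_pow4; exact: (hf 3).
Qed.

End TruncatedAlgebra.

(** * The level algebra of a tensor *)

Section AlgebraOfTensor.
Local Open Scope ring_scope.
Local Open Scope classical_set_scope.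
Variables (k : fieldType) (m tau : nat) (D : 'M[k]_(m * m, m * tau)).
Hypotheses (tau_gt0 : (0 < tau)%N) (symD : symmetric_tensor D)
  (fullD : row_full (flattening D)).
Local Notation n := (\rank D).
Local Notation ix := (@mxvec_index _ _).
Local Notation V := 'rV[k]_m.

(** The space of degree two consists of the maps [V -> k^tau] spanned by those
    that two vectors [v], [w] induce through the trilinear forms: a full rank factorization of the catalecticant gives [k^n] as
    coordinates on it, the left factor being the product [V x V -> k^n] and the
    right one the pairing [V x k^n -> k^tau]. *)
Definition tensor_mul11 (v w : V) : 'rV_n := mxvec (v^T *m w) *m col_base D.

Definition tensor_mul12 (u : V) (b : 'rV_n) : 'rV_tau :=
  u *m vec_mx (b *m row_base D).

Lemma tensor_mul111E u v w i : tensor_mul12 u (tensor_mul11 v w) 0 i =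
  \sum_r \sum_p \sum_q u 0 r * v 0 p * w 0 q * D (ix p q) (ix r i).
Proof.
rewrite /tensor_mul12 /tensor_mul11 -mulmxA mulmx_base mxE.
apply: eq_bigr => r _; rewrite mxE mxE sum_mxvec_index mulr_sumr.
apply: eq_bigr => p _; rewrite mulr_sumr; apply: eq_bigr => q _.
by rewrite mxvecE mxE big_ord1 mxE !mulrA.
Qed.

Lemma tensor_mul11C v w : tensor_mul11 v w = tensor_mul11 w v.
Proof.
apply: (row_free_inj (row_base_free D)).
rewrite /tensor_mul11 /= -[LHS]mulmxA -[RHS]mulmxA mulmx_base.
apply/rowP => x; case/mxvec_indexP: x => r i.
rewrite !mxE !sum_mxvec_index exchange_big.
apply: eq_bigr => p _; apply: eq_bigr => q _.
rewrite !mxvecE !mxE !big_ord1 !mxE mulrC [v _ _ * _]mulrC.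
by have [-> _] := symD q p r i; rewrite mulrC.
Qed.

Lemma tensor_mul12A u v w :
  tensor_mul12 u (tensor_mul11 v w) = tensor_mul12 w (tensor_mul11 u v).
Proof.
apply/rowP => i; rewrite !tensor_mul111E.
under eq_bigr do rewrite exchange_big.
rewrite exchange_big; apply: eq_bigr => q _ /=.
apply: eq_bigr => r _; apply: eq_bigr => p _.
have -> : D (ix p q) (ix r i) = D (ix r p) (ix q i).
  have [_ ->] := symD p q r i; have [-> _] := symD p r q i.
  by [].
by congr (_ * _); ring.
Qed.

Lemma tensor_mul11_gen (P : 'rV[k]_n -> Prop) :
  P 0 -> (forall b b', P b -> P b' -> P (b + b')) ->
  (forall v w, P (tensor_mul11 v w)) -> forall b, P b.
Proof.
move=> P0 PD PM b; have /row_fullP[B BC] := col_base_full D.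
rewrite -[b]mulmx1 -BC mulmxA mulmx_sum_row sum_mxvec_index.
apply: (big_ind P) => // p _; apply: (big_ind P) => // q _.
set a := _ 0 _; suff <- : tensor_mul11 (a *: 'e_p) 'e_q = a *: row (ix p q) (col_base D).
  exact: PM.
rewrite /tensor_mul11 linearZ /= -scalemxAl trmx_delta mul_delta_mx.
by rewrite linearZ /= mxvec_delta -scalemxAl -rowE.
Qed.

Lemma tensor_mul12_gen (P : 'rV[k]_tau -> Prop) :
  P 0 -> (forall t t', P t -> P t' -> P (t + t')) ->
  (forall u v w, P (tensor_mul12 u (tensor_mul11 v w))) -> forall t, P t.
Proof.
move=> P0 PD PM t; have /row_fullP[B BC] := fullD.
rewrite -[t]mulmx1 -BC mulmxA mulmx_sum_row sum_mxvec_index.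
apply: (big_ind P) => // x _; apply: (big_ind P) => // r _.
case/mxvec_indexP: x => p q; set a := _ 0 _.
suff <- : tensor_mul12 'e_r (tensor_mul11 (a *: 'e_p) 'e_q) =
    a *: row (ix (ix p q) r) (flattening D) by exact: PM.
rewrite /tensor_mul11 linearZ /= -scalemxAl trmx_delta mul_delta_mx.
rewrite linearZ /= mxvec_delta /tensor_mul12 -!scalemxAl -mulmxA mulmx_base.
rewrite linearZ /= -scalemxAr -rowE; congr (_ *: _); apply/rowP => i.
by rewrite -rowE [RHS]mxE flatteningE !mxE.
Qed.

Lemma tensor_mul11P u a v w :
  tensor_mul11 u (a *: v + w) = a *: tensor_mul11 u v + tensor_mul11 u w.
Proof. by rewrite /tensor_mul11 mulmxDr -scalemxAr linearP /= mulmxDl -scalemxAl. Qed.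

Lemma tensor_mul12Pl b a v w :
  tensor_mul12 (a *: v + w) b = a *: tensor_mul12 v b + tensor_mul12 w b.
Proof. by rewrite /tensor_mul12 mulmxDl -scalemxAl. Qed.

Lemma tensor_mul12Pr u a v w :
  tensor_mul12 u (a *: v + w) = a *: tensor_mul12 u v + tensor_mul12 u w.
Proof.
by rewrite /tensor_mul12 mulmxDl -scalemxAl linearP /= mulmxDr -scalemxAr.
Qed.

Lemma tensor_mul12_inj b : (forall u, tensor_mul12 u b = 0) -> b = 0.
Proof.
move=> b0; apply: (row_free_inj (row_base_free D)); rewrite /= mul0mx.
apply: (can_inj vec_mxK); rewrite linear0; apply/row_matrixP => p.
by rewrite row0 rowE; apply: b0.
Qed.

(** The product [tensor_mul11] may vanish on a subspace [U] of [V], whose vectors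
    would then be socle elements of degree one.  A correction with values in a
    line of the top degree, nondegenerate on [U], removes them, and it creates
    no socle elements of mixed degree because the pairing with degree two
    vanishes on [U]. *)
Lemma level_h_vector_of_tensor : is_level_h_vector k [:: 1; m; n; tau]%N.
Proof.
have [U UP] : exists U : {vspace V}, forall v,
    (forall w, tensor_mul11 v w = 0) <-> v \in U.
  apply: (@subspace_vspace _ _ (fun v => forall w, tensor_mul11 v w = 0)).
    by move=> w; rewrite /tensor_mul11 trmx0 mul0mx linear0 mul0mx.
  move=> a v w v0 w0 u; rewrite tensor_mul11C tensor_mul11P.
  by rewrite ![tensor_mul11 u _]tensor_mul11C v0 w0 scaler0 addr0.
have [q [qC qP q_nondeg]] := symmetric_form_on U.
pose e : 'rV[k]_tau := 'e_(Ordinal tau_gt0).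
pose G := GradedProduct (cor11 := fun v w => q v w *: e)
  tensor_mul11C tensor_mul11P (fun v w => congr1 (fun c => c *: e) (qC v w))
  (fun u a v w => etrans (congr1 (fun c => c *: e) (qP u a v w))
     (etrans (scalerDl _ _ _) (congr1 (fun x => x + _) (esym (scalerA _ _ _)))))
  tensor_mul12Pl tensor_mul12Pr tensor_mul12A.
have gen11 := tensor_mul11_gen; have gen12 := tensor_mul12_gen.
exists (truncated_algebra G), (@trunc_max _ _ _ _ G); split.
- exact: (@trunc_artinian_local _ _ _ _ G gen11 gen12).
- apply: (@trunc_level _ _ _ _ G gen11 gen12 tau_gt0) => v b vb.
  have vU : v \in U by apply/UP => w; have [] := vb w.
  have mul12U w : w \in U -> tensor_mul12 w b = 0.
    move=> /UP w0; move: b {vb}; apply: gen11.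
    - by rewrite /tensor_mul12 mul0mx linear0 mulmx0.
    - move=> b b' b0 b'0; have := tensor_mul12Pr w 1 b b'.
      by rewrite !scale1r b0 b'0 addr0.
    - move=> x y; rewrite tensor_mul12A w0.
      by rewrite /tensor_mul12 mul0mx linear0 mulmx0.
  have v0 : v = 0.
    apply: q_nondeg vU _ => w wU; have [_ /=] := vb w.
    rewrite mul12U // addr0 => /rowP/(_ (Ordinal tau_gt0)).
    by rewrite !mxE !eqxx mulr1.
  split=> //; apply: tensor_mul12_inj => w; have [_ /=] := vb w.
  rewrite v0 qC; have := qP w 0 0 0; rewrite scaler0 add0r mul0r add0r.
  by have := qP w 1 0 0; rewrite scaler0 addr0 mul1r => /esym/eqP;
    rewrite -subr_eq0 addrK => /eqP -> _; rewrite scale0r add0r.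
- exact: (@trunc_h_vector _ _ _ _ G gen11 gen12 tau_gt0).
Qed.

End AlgebraOfTensor.

Theorem theorem4p3 (k : closedFieldType) (char0 : [pchar k]%R =i pred0)
    (m n tau : nat) (m_gt0 : 0 < m) (n_gt0 : 0 < n) (tau_gt0 : 0 < tau) :
  is_h_vector k [:: 1; m; n; tau] ->
  (is_level_h_vector k [:: 1; m; n; tau] <-> n <= tau * m).
Proof.
move=> hH; split=> [|n_le].
  move=> [A [M [[_ [idM _ _] _ _] [s' [tau' [sd' socM _]]] [s [sd sz hf]]]]].
  have s3 : s = 3 by case: sz.
  have s'3 : s' = 3 by rewrite (socle_degree_unique idM sd' sd).
  subst s s'; have [_ M4] := sd; rewrite mulnC.
  have [e [e_in e_gen _]]
      : quo_dim (ideal_pow M 1) (ideal_pow M 2) m := hf 1 isT.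
  have [f [f_in f_gen f_free]]
      : quo_dim (ideal_pow M 2) (ideal_pow M 3) n := hf 2 isT.
  have [g [g_in g_gen _]]
      : quo_dim (ideal_pow M 3) (ideal_pow M 4) tau := hf 3 isT.
  exact: (level_type_bound idM M4 e_in e_gen f_in f_free g_gen socM).
case: m m_gt0 n_le hH => // m' _ n_le [A [M [[_ [idM _ _] _ _] [s [sd sz hf]]]]].
have s3 : s = 3 by case: sz.
subst s; have [_ M4] := sd.
have [e [e_in e_gen _]]
      : quo_dim (ideal_pow M 1) (ideal_pow M 2) m'.+1 := hf 1 isT.
have [f [f_in f_gen f_free]]
      : quo_dim (ideal_pow M 2) (ideal_pow M 3) n := hf 2 isT.
have [g [g_in g_gen g_free]]
      : quo_dim (ideal_pow M 3) (ideal_pow M 4) tau := hf 3 isT.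
have [mu [D0 [mu_sym mu_full symD0 fullD0 rkD0]]] :=
  multiplication_tensor idM M4 e_in e_gen f_in f_gen f_free g_in g_gen g_free.
have two : (2%:R != 0 :> k)%R by rewrite (pcharf0P k).1.
have rkH : n <= \rank (cyclic_tensor k m' tau).
  by apply: cyclic_tensor_rank two _ mu_full mu_sym; rewrite mulnC.
have [D [symD fullD <-]] := exists_symmetric_tensor_rank char0 symD0 fullD0 rkD0
  (@cyclic_tensor_sym k m' tau) rkH.
exact: level_h_vector_of_tensor tau_gt0 symD fullD.
Qed.
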